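(* Let $f(z)=z+\sum_{n=2}^{\infty} a_n z^n$ be in the class $\mathcal{S}_{\sigma}^{\ast}$ of bi-starlike functions. Then $$\left| a_2 a_4-a_3^2\right| \leq \frac{20}{3}.$$
   Context: Let $\mathcal{U}=\{z\in\mathbb{C}:|z|<1\}$. Let $\mathcal{A}$ be the family of functions $f$ analytic in $\mathcal{U}$ of the form $f(z)=z+\sum_{n=2}^{\infty}a_n z^n$, and let $\mathcal{S}\subset\mathcal{A}$ be the subclass of functions univalent (injective) in $\mathcal{U}$. Every $f\in\mathcal{S}$ has an inverse $f^{-1}$ satisfying $f^{-1}(f(z))=z$ for $z\in\mathcal{U}$ and $f(f^{-1}(w))=w$ for $|w|<r_0(f)$, where $r_0(f)\geq 1/4$. A function $f\in\mathcal{A}$ is bi-univalent in $\mathcal{U}$ if both $f$ and $f^{-1}$ are univalent in $\mathcal{U}$ (that is, $f$ is univalent in $\mathcal{U}$ and $f^{-1}$, defined near $0$, has an analytic continuation to $\mathcal{U}$, still denoted $f^{-1}$, which is univalent in $\mathcal{U}$); $\sigma$ denotes the class of bi-univalent functions. The class of starlike functions is $\mathcal{S}^{\ast}=\{f\in\mathcal{S}:\Re(zf'(z)/f(z))>0 \text{ for all } z\in\mathcal{U}\}$ (with the value of $zf'(z)/f(z)$ at $z=0$ taken to be $1$). A function $f\in\sigma$ belongs to $\mathcal{S}_{\sigma}^{\ast}$ (bi-starlike) if both $f$ and its inverse $f^{-1}$ are starlike in $\mathcal{U}$. *)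

(* Defs.v *)
From Stdlib Require Import Reals.
From Coquelicot Require Import Coquelicot.
Open Scope R_scope.

(* Functions on the unit disc are total functions C -> C; every notion below
   depends only on their values in the disc. *)
Definition unit_disc (z : C) : Prop := Cmod z < 1.

Definition analytic_on (D : C -> Prop) (f : C -> C) : Prop :=
  forall z : C, D z -> ex_derive (K := C_AbsRing) (V := C_NormedModule) f z.

Definition injective_on (D : C -> Prop) (f : C -> C) : Prop :=
  forall z1 z2 : C, D z1 -> D z2 -> f z1 = f z2 -> z1 = z2.

Definition univalent_on (D : C -> Prop) (f : C -> C) : Prop :=
  analytic_on D f /\ injective_on D f.

(* f(z) = z + sum_{n >= 2} a_n z^n in the unit disc; the sequence [a] is
   completed by a_0 = 0 and a_1 = 1. *)
Definition normalized_expansion (f : C -> C) (a : nat -> C) : Prop :=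
  a 0%nat = RtoC 0 /\ a 1%nat = RtoC 1 /\
  forall z : C, unit_disc z ->
    is_pseries (K := C_AbsRing) (V := C_NormedModule) a z (f z).

Definition class_A (f : C -> C) : Prop :=
  analytic_on unit_disc f /\ exists a : nat -> C, normalized_expansion f a.

Definition class_S (f : C -> C) : Prop :=
  class_A f /\ univalent_on unit_disc f.

(* On a disc |w| < r the values of g are the preimages under f, in the unit
   disc, of w: for f injective, g is there the inverse of f.  Since g is analytic
   in the unit disc, its values there are determined by f. *)
Definition inverse_continuation (f g : C -> C) : Prop :=
  analytic_on unit_disc g /\
  exists r : R, 0 < r /\
    forall w : C, Cmod w < r -> unit_disc (g w) /\ f (g w) = w.

Definition bi_univalent (f : C -> C) : Prop :=
  class_A f /\ univalent_on unit_disc f /\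
  exists g : C -> C, inverse_continuation f g /\ univalent_on unit_disc g.

Definition starlike_quotient (f : C -> C) (z : C) : C :=
  if Ceq_dec z 0 then RtoC 1 else (z * C_derive f z / f z)%C.

Definition starlike (f : C -> C) : Prop :=
  class_S f /\ forall z : C, unit_disc z -> 0 < Re (starlike_quotient f z).

Definition bi_starlike (f : C -> C) : Prop :=
  bi_univalent f /\ starlike f /\
  exists g : C -> C, inverse_continuation f g /\ starlike g.

(* Main.v *)
Require Import Defs.
From Stdlib Require Import Reals.
From Coquelicot Require Import Coquelicot.
From Stdlib Require Import Lra Lia.
Open Scope R_scope.

(* Write
   z f'(z) / f(z) = 1 + c_1 z + c_2 z^2 + c_3 z^3 + ... .  Comparing
   coefficients gives a_2 a_4 - a_3^2 = c_1 c_3 / 3 - c_2^2 / 4 - c_1^4 / 12, and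
   Caratheodory's inequality |c_n| <= 2 for functions of positive real part bounds
   this by 4/3 + 1 + 4/3 = 11/3.
   Caratheodory's inequality follows from the mean value property on the circle
   |z| = r: if |e| = 1 and e c_n = |c_n|, then the nonnegative function
   Re p(z) * (2 r^n - 2 Re (e conj(z)^n)) agrees on that circle with the real part of
   a holomorphic function whose value at 0 is 2 r^n - r^(2n) |c_n|. *)

(** * Complex and real derivatives *)

Lemma norm_C_R (z : C) : norm (K := R_AbsRing) (V := C_R_NormedModule) z = Cmod z.
Proof.
change (sqrt (Rabs (fst z) ^ 2 + Rabs (snd z) ^ 2) = Cmod z).
now rewrite !pow2_abs.
Qed.

(** Since [Re] is real-linear and bounded by the modulus, the little-o estimate for [h] passes to
    [Re h]. By [locally_C], the modulus and the product structure give the same neighbourhoods. *)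
Lemma filterdiff_Re_real (h : C -> C) (z d : C) :
  is_derive (K := C_AbsRing) (V := C_NormedModule) h z d ->
  filterdiff (K := R_AbsRing) (U := C_R_NormedModule) (V := R_NormedModule)
    (fun w => Re (h w)) (locally z) (fun y => Re (Cmult d y)).
Proof.
intros [_ Hd]. split.
- split.
  + intros u v.
    change (Re (d * (u + v))%C = Re (d * u)%C + Re (d * v)%C). unfold Re; simpl; ring.
  + intros k u.
    change (Re (Cmult d (k * fst u, k * snd u)) = k * Re (Cmult d u)). unfold Re; simpl; ring.
  + exists (Cmod d + 1); split; [ generalize (Cmod_ge_0 d); lra |].
    intros y. rewrite norm_C_R. change (Rabs (Re (Cmult d y)) <= (Cmod d + 1) * Cmod y).
    eapply Rle_trans; [apply re_le_Cmod|]. rewrite Cmod_mult.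
    generalize (Cmod_ge_0 y); lra.
- intros w Hw eps.
  assert (Hw' : w = z).
  { symmetry; apply (is_filter_lim_locally_unique (V := C_R_NormedModule) z w Hw). }
  subst w.
  specialize (Hd z (fun P HP => HP) eps).
  apply locally_C in Hd.
  revert Hd; apply filter_imp. intros y Hy.
  rewrite norm_C_R.
  eapply Rle_trans; [|exact Hy].
  eapply Rle_trans; [|apply re_le_Cmod].
  right; unfold norm; simpl; unfold abs; simpl; f_equal.
  change ((Re (h y) + - Re (h z)) + - Re (d * (y + - z))%C
    = Re ((h y + - h z) + - ((y + - z) * d))%C).
  unfold Re; simpl; ring.
Qed.

(** Chain rule along a real curve, meant for radii and circles. The curve is differentiated
    coordinatewise as a map into the real plane. *)
Lemma is_derive_Re_comp (h : C -> C) (x y : R -> R) (t dx dy : R) (d : C) :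
  is_derive (K := C_AbsRing) (V := C_NormedModule) h (x t, y t) d ->
  is_derive x t dx -> is_derive y t dy ->
  is_derive (fun s => Re (h (x s, y s))) t (Re (Cmult d (dx, dy))).
Proof.
intros Hh Hx Hy.
apply filterdiff_Re_real in Hh.
assert (Hp : filterdiff (K := R_AbsRing) (U := R_NormedModule) (V := C_R_NormedModule)
   (fun s => (x s, y s)) (locally t) (fun u => (scal u dx, scal u dy))).
{ apply (filterdiff_comp_2 (K := R_AbsRing) (T := R_NormedModule) (U := R_NormedModule)
    (V := R_NormedModule) (W := C_R_NormedModule)
    x y (fun a b => (a, b)) _ _ (fun a b => (a, b)) Hx Hy).
  apply filterdiff_linear.
  apply (is_linear_prod (K := R_AbsRing)
    (T := prod_NormedModule R_AbsRing R_NormedModule R_NormedModule)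
    (U := R_NormedModule) (V := R_NormedModule)).
  - apply is_linear_fst.
  - apply is_linear_snd. }
unfold is_derive.
eapply filterdiff_ext_lin.
- apply (filterdiff_comp' (K := R_AbsRing) (U := R_NormedModule) (V := C_R_NormedModule)
    (W := R_NormedModule) (fun s => (x s, y s)) (fun w => Re (h w)) t _ _ Hp Hh).
- intros u; simpl; unfold scal; simpl; unfold mult; simpl; ring.
Qed.

(** Both module structures on [C] have convertible operations and norms, so the components of one
    proof serve for the other. The product and chain rules refer to the ring's own structure. *)
Lemma is_derive_C_AbsRing (h : C -> C) (z d : C) :
  is_derive (K := C_AbsRing) (V := C_NormedModule) h z d <->
  is_derive (K := C_AbsRing) (V := AbsRing_NormedModule C_AbsRing) h z d.
Proof.
split; intros [[H1 H2 H3] Hd]; (split; [split; assumption | exact Hd]).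
Qed.

Lemma is_derive_C_continuous (h : C -> C) (z d : C) :
  is_derive (K := C_AbsRing) (V := C_NormedModule) h z d ->
  continuous (T := C_UniformSpace) (U := C_UniformSpace) h z.
Proof.
intros H P HP.
assert (Hc := ex_derive_continuous (K := C_AbsRing) (V := C_NormedModule)
  h z (ex_intro _ d H) P HP).
apply locally_C, Hc.
Qed.

Lemma is_derive_Cmult (h k : C -> C) (z dh dk : C) :
  is_derive (K := C_AbsRing) (V := C_NormedModule) h z dh ->
  is_derive (K := C_AbsRing) (V := C_NormedModule) k z dk ->
  is_derive (K := C_AbsRing) (V := C_NormedModule)
    (fun w => (h w * k w)%C) z (dh * k z + h z * dk)%C.
Proof.
intros Hh Hk. apply is_derive_C_AbsRing.
apply (is_derive_mult (K := C_AbsRing) h k).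
- now apply is_derive_C_AbsRing.
- now apply is_derive_C_AbsRing.
- exact Cmult_comm.
Qed.

Lemma is_derive_C_eps (h : C -> C) (z d : C) :
  (forall eps : R, 0 < eps -> exists delta : R, 0 < delta /\
     forall w : C, Cmod (w - z) < delta ->
       Cmod (h w - h z - d * (w - z)) <= eps * Cmod (w - z)) ->
  is_derive (K := C_AbsRing) (V := C_NormedModule) h z d.
Proof.
intros H. split.
- apply (is_linear_scal_l (K := C_AbsRing) (V := C_NormedModule)).
- intros x Hx eps.
  assert (Hz : z = x)
    by exact (is_filter_lim_locally_unique (V := AbsRing_NormedModule C_AbsRing) _ _ Hx).
  subst x.
  destruct (H eps (cond_pos eps)) as [delta [Hdelta Hw]].
  exists (mkposreal delta Hdelta). intros w Hzw.
  change (Cmod (h w - h z - (w - z) * d) <= eps * Cmod (w - z)).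
  rewrite (Cmult_comm (w - z)). now apply Hw.
Qed.

Lemma is_derive_Cinv_id (z : C) : z <> 0 ->
  is_derive (K := C_AbsRing) (V := C_NormedModule) Cinv z (- / z ^ 2)%C.
Proof.
intros Hz. apply is_derive_C_eps. intros eps Heps.
assert (Hpos : 0 < Cmod z) by now apply Cmod_gt_0.
(* The first bound keeps [Cmod w] above [Cmod z / 2]. The second then makes the exact remainder
   [(w - z)^2 / (w z^2)] at most [eps * Cmod (w - z)]. *)
exists (Rmin (Cmod z / 2) (eps * Cmod z ^ 3 / 2)). split.
- apply Rmin_pos; [lra|]. apply Rmult_lt_0_compat; [|lra].
  apply Rmult_lt_0_compat; [lra|]. now apply pow_lt.
- intros w Hw.
  assert (H1 := Rlt_le_trans _ _ _ Hw (Rmin_l _ _)).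
  assert (H2 := Rlt_le_trans _ _ _ Hw (Rmin_r _ _)).
  assert (Hlow : Cmod z / 2 <= Cmod w).
  { assert (H3 := Cmod_triangle w (- (w - z))).
    replace (w + - (w - z))%C with z in H3 by ring.
    rewrite Cmod_opp in H3. lra. }
  assert (Hw0 : w <> 0) by (apply Cmod_gt_0; lra).
  replace (/ w - / z - - / z ^ 2 * (w - z))%C
    with ((w - z) * (w - z) * / (w * z ^ 2))%C by (field; auto).
  rewrite !Cmod_mult, Cmod_inv, Cmod_mult, Cmod_pow
    by (apply Cmult_neq_0; auto; apply Cpow_nz; auto).
  rewrite Rmult_assoc, (Rmult_comm eps).
  apply Rmult_le_compat_l; [apply Cmod_ge_0|].
  apply Rle_div_l; [apply Rlt_gt, Rmult_lt_0_compat; [lra | now apply pow_lt]|].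
  apply Rlt_le, (Rlt_le_trans _ _ _ H2).
  replace (eps * Cmod z ^ 3 / 2) with (eps * Cmod z ^ 2 * (Cmod z / 2)) by field.
  replace (eps * (Cmod w * Cmod z ^ 2)) with (eps * Cmod z ^ 2 * Cmod w) by ring.
  apply Rmult_le_compat_l; [|exact Hlow].
  apply Rmult_le_pos; [lra | apply pow2_ge_0].
Qed.

Lemma is_derive_Cinv (h : C -> C) (z dh : C) :
  is_derive (K := C_AbsRing) (V := C_NormedModule) h z dh -> h z <> 0 ->
  is_derive (K := C_AbsRing) (V := C_NormedModule)
    (fun w => (/ h w)%C) z (dh * - / h z ^ 2)%C.
Proof.
intros Hh Hz.
apply (is_derive_comp (K := C_AbsRing) (V := C_NormedModule) Cinv h).
- now apply is_derive_Cinv_id.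
- now apply is_derive_C_AbsRing.
Qed.

(** * The mean value property *)

(** Continuity of the derivative is included because differentiation under the integral sign uses
    it. *)
Definition continuously_holomorphic (h : C -> C) : Prop :=
  exists dh : C -> C, forall z, unit_disc z ->
    is_derive (K := C_AbsRing) (V := C_NormedModule) h z (dh z) /\
    continuous (T := C_UniformSpace) (U := C_UniformSpace) dh z.

(** The radius [s] may be negative, which makes 0 an interior point of the range of radii. *)
Definition polar (s t : R) : C := (s * cos t, s * sin t).

Lemma Cmod_polar s t : Cmod (polar s t) = Rabs s.
Proof.
unfold Cmod, polar; simpl.
replace (_ + _) with (Rsqr s * (Rsqr (sin t) + Rsqr (cos t))) by (unfold Rsqr; ring).
rewrite sin2_cos2, Rmult_1_r. apply sqrt_Rsqr_abs.
Qed.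

Lemma is_derive_Re_polar_radius (h : C -> C) (s t : R) (d : C) :
  is_derive (K := C_AbsRing) (V := C_NormedModule) h (polar s t) d ->
  is_derive (fun u => Re (h (polar u t))) s (Re (Cmult d (polar 1 t))).
Proof.
intros H.
apply (is_derive_Re_comp h (fun u => u * cos t) (fun u => u * sin t)).
- exact H.
- auto_derive; trivial.
- auto_derive; trivial.
Qed.

(** Apply the chain rule to [Im h = Re (-i h)]: the factor [-i] cancels the [i] in the tangent
    vector [i s e^(it)] of the circle. The result is [s] times the radial derivative of [Re h], a
    Cauchy-Riemann equation. *)
Lemma is_derive_Im_polar_angle (h : C -> C) (s t : R) (d : C) :
  is_derive (K := C_AbsRing) (V := C_NormedModule) h (polar s t) d ->
  is_derive (fun u => Im (h (polar s u))) t (s * Re (Cmult d (polar 1 t))).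
Proof.
intros H.
assert (H2 : is_derive (K := C_AbsRing) (V := C_NormedModule)
  (fun z => Cmult (- Ci) (h z)) (polar s t) (Cmult (- Ci) d)).
{ replace (Cmult (-Ci) d) with (0 * h (polar s t) + (-Ci) * d)%C by ring.
  apply (is_derive_Cmult (fun _ => (- Ci)%C)); [|exact H].
  apply (is_derive_const (K := C_AbsRing) (V := C_NormedModule)). }
apply (is_derive_ext (fun u => Re (Cmult (-Ci) (h (polar s u))))).
{ intros u; simpl. unfold Im. ring. }
replace (s * _) with (Re (Cmult (Cmult (-Ci) d) (-s * sin t, s * cos t))).
apply (is_derive_Re_comp (fun z => Cmult (-Ci) (h z)) (fun u => s * cos u) (fun u => s * sin u)).
- exact H2.
- auto_derive; trivial. ring.
- auto_derive; trivial. ring.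
- destruct d; simpl; ring.
Qed.

Lemma continuous_comp_polar (k : C -> C) (p : R * R) :
  continuous (T := C_UniformSpace) (U := C_UniformSpace) k (polar (fst p) (snd p)) ->
  continuous (U := C_UniformSpace) (fun q : R * R => k (polar (fst q) (snd q))) p.
Proof.
destruct p as [s t]; intros H.
apply (continuous_comp_2 (fun q : R * R => fst q * cos (snd q))
  (fun q : R * R => fst q * sin (snd q)) (fun x y : R => k (x, y))).
- apply (continuity_2d_pt_filterlim (fun u v => u * cos v)).
  apply continuity_2d_pt_mult; [apply continuity_2d_pt_id1|].
  apply (continuity_1d_2d_pt_comp cos); [apply continuity_cos | apply continuity_2d_pt_id2].
- apply (continuity_2d_pt_filterlim (fun u v => u * sin v)).
  apply continuity_2d_pt_mult; [apply continuity_2d_pt_id1|].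
  apply (continuity_1d_2d_pt_comp sin); [apply continuity_sin | apply continuity_2d_pt_id2].
- revert H. apply continuous_ext. now intros [x y].
Qed.

Lemma continuity_2d_Re_polar (k : C -> C) (s t : R) :
  continuous (T := C_UniformSpace) (U := C_UniformSpace) k (polar s t) ->
  continuity_2d_pt (fun u v => Re (Cmult (k (polar u v)) (polar 1 v))) s t.
Proof.
intros H.
assert (Hp := continuous_comp_polar k (s, t) H).
assert (H1 : continuity_2d_pt (fun u v => Re (k (polar u v))) s t).
{ apply continuity_2d_pt_filterlim.
  apply (continuous_comp _ (fun z : R * R => fst z) _ Hp), continuous_fst. }
assert (H2 : continuity_2d_pt (fun u v => Im (k (polar u v))) s t).
{ apply continuity_2d_pt_filterlim.
  apply (continuous_comp _ (fun z : R * R => snd z) _ Hp), continuous_snd. }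
apply (continuity_2d_pt_ext
  (fun u v => Re (k (polar u v)) * cos v - Im (k (polar u v)) * sin v)).
{ intros u v. unfold Re, Im, polar; simpl. ring. }
apply continuity_2d_pt_minus; apply continuity_2d_pt_mult; trivial.
- apply (continuity_1d_2d_pt_comp cos); [apply continuity_cos | apply continuity_2d_pt_id2].
- apply (continuity_1d_2d_pt_comp sin); [apply continuity_sin | apply continuity_2d_pt_id2].
Qed.

Lemma locally_Rabs_lt_1 (s : R) : Rabs s < 1 -> locally s (fun u => Rabs u < 1).
Proof.
intros Hs.
apply (locally_interval _ s (-1) 1); simpl; try (apply Rabs_def2 in Hs; lra).
intros y H1 H2; apply Rabs_def1; lra.
Qed.

Lemma ex_RInt_Re_polar (h : C -> C) (s : R) :
  continuously_holomorphic h -> Rabs s < 1 ->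
  ex_RInt (fun t => Re (h (polar s t))) 0 (2 * PI).
Proof.
intros [dh Hh] Hs.
apply (ex_RInt_continuous (V := R_CompleteNormedModule)). intros t _.
assert (Hc : continuous (U := C_UniformSpace) (fun u => h (polar s u)) t).
{ apply (continuous_comp (fun u : R => (s, u)) (fun q : R * R => h (polar (fst q) (snd q)))).
  - apply (continuous_comp_2 (fun _ => s) (fun u => u) (fun x y : R => (x, y))).
    + apply continuous_const.
    + apply continuous_id.
    + apply continuous_ext with (2 := continuous_id _). now intros [x y].
  - apply continuous_comp_polar. simpl.
    apply is_derive_C_continuous with (dh (polar s t)).
    apply Hh. unfold unit_disc. now rewrite Cmod_polar. }
apply (continuous_comp _ (fun z : R * R => fst z) _ Hc), continuous_fst.
Qed.

(** Differentiation under the integral sign; the radial derivative of the integrand is jointly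
    continuous in radius and angle because [dh] is continuous. *)
Lemma is_derive_circle_integral (h dh : C -> C) (s : R) :
  (forall z, unit_disc z ->
    is_derive (K := C_AbsRing) (V := C_NormedModule) h z (dh z) /\
    continuous (T := C_UniformSpace) (U := C_UniformSpace) dh z) ->
  Rabs s < 1 ->
  is_derive (fun u => RInt (fun t => Re (h (polar u t))) 0 (2 * PI)) s
    (RInt (fun t => Re (Cmult (dh (polar s t)) (polar 1 t))) 0 (2 * PI)).
Proof.
intros Hh Hs.
assert (Hd : forall u t, Rabs u < 1 ->
  is_derive (fun v => Re (h (polar v t))) u (Re (Cmult (dh (polar u t)) (polar 1 t)))).
{ intros u t Hu. apply is_derive_Re_polar_radius, Hh. unfold unit_disc.
  now rewrite Cmod_polar. }
rewrite <- (RInt_ext (fun t => Derive (fun u => Re (h (polar u t))) s))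
  by (intros t _; now apply is_derive_unique, Hd).
apply (is_derive_RInt_param (fun u t => Re (h (polar u t)))).
- apply (filter_imp (fun u => Rabs u < 1)); [|now apply locally_Rabs_lt_1].
  intros u Hu t _. eexists. now apply Hd.
- intros t _.
  apply (continuity_2d_pt_ext_loc (fun u v => Re (Cmult (dh (polar u v)) (polar 1 v)))).
  + destruct (locally_Rabs_lt_1 s Hs) as [delta Hdelta].
    exists delta. intros u v Hu _. symmetry. apply is_derive_unique, Hd. now apply Hdelta.
  + apply continuity_2d_Re_polar, Hh. unfold unit_disc. now rewrite Cmod_polar.
- apply (filter_imp (fun u => Rabs u < 1)); [|now apply locally_Rabs_lt_1].
  intros u Hu. apply ex_RInt_Re_polar; trivial. now exists dh.
Qed.

(* By the Cauchy-Riemann equations the integrand is [1 / s] times the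
   [t]-derivative of the periodic function [Im (h (polar s t))]. *)
Lemma circle_integral_derivative_0 (h dh : C -> C) (s : R) :
  (forall z, unit_disc z ->
    is_derive (K := C_AbsRing) (V := C_NormedModule) h z (dh z) /\
    continuous (T := C_UniformSpace) (U := C_UniformSpace) dh z) ->
  Rabs s < 1 -> s <> 0 ->
  RInt (fun t => Re (Cmult (dh (polar s t)) (polar 1 t))) 0 (2 * PI) = 0.
Proof.
intros Hh Hs Hs0.
assert (Hdisc : forall t, unit_disc (polar s t))
  by (intros t; unfold unit_disc; now rewrite Cmod_polar).
assert (HI : is_RInt (fun t => Re (Cmult (dh (polar s t)) (polar 1 t))) 0 (2 * PI)
  (minus (Im (h (polar s (2 * PI))) / s) (Im (h (polar s 0)) / s))).
{ apply (is_RInt_derive (V := R_CompleteNormedModule) (fun t => Im (h (polar s t)) / s)).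
  - intros t _.
    replace (Re (dh (polar s t) * polar 1 t)%C)
      with (s * Re (dh (polar s t) * polar 1 t)%C * / s) by (field; exact Hs0).
    apply (is_derive_scal_l (K := R_AbsRing) (V := R_NormedModule)
      (fun u => Im (h (polar s u))) t _ (/ s)).
    apply is_derive_Im_polar_angle, Hh, Hdisc.
  - intros t _.
    apply (continuous_comp (fun u : R => (s, u))
      (fun q : R * R => Re (Cmult (dh (polar (fst q) (snd q))) (polar 1 (snd q))))).
    + apply (continuous_comp_2 (fun _ => s) (fun u => u) (fun x y : R => (x, y))).
      * apply continuous_const.
      * apply continuous_id.
      * apply continuous_ext with (2 := continuous_id _). now intros [x y].
    + apply (continuity_2d_pt_filterlim
        (fun u v => Re (Cmult (dh (polar u v)) (polar 1 v)))).
      apply continuity_2d_Re_polar, Hh, Hdisc. }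
rewrite (is_RInt_unique _ _ _ _ HI).
replace (polar s (2 * PI)) with (polar s 0).
- exact (minus_eq_zero (G := R_AbelianGroup) _).
- unfold polar. now rewrite cos_2PI, sin_2PI, cos_0, sin_0.
Qed.

(** As a function of the radius, the circle integral is continuous on [[0, r]] and has derivative 0
    inside. Hence it equals its value at radius 0, where the integrand is the constant
    [Re (h 0)]. *)
Lemma circle_mean_value (h : C -> C) (r : R) :
  continuously_holomorphic h -> 0 < r < 1 ->
  RInt (fun t => Re (h (polar r t))) 0 (2 * PI) = 2 * PI * Re (h 0).
Proof.
intros Hc Hr. destruct Hc as [dh Hh].
destruct (MVT_gen (fun u => RInt (fun t => Re (h (polar u t))) 0 (2 * PI)) 0 r (fun _ => 0))
  as [c [_ Hc]].
- rewrite Rmin_left, Rmax_right by lra. intros s Hs.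
  assert (Hs1 : Rabs s < 1) by (apply Rabs_def1; lra).
  assert (HD := is_derive_circle_integral h dh s Hh Hs1).
  rewrite (circle_integral_derivative_0 h dh s Hh Hs1) in HD by lra.
  exact HD.
- rewrite Rmin_left, Rmax_right by lra. intros s Hs.
  assert (Hs1 : Rabs s < 1) by (apply Rabs_def1; lra).
  apply continuity_pt_filterlim.
  exact (ex_derive_continuous (V := R_NormedModule) _ s
    (ex_intro _ _ (is_derive_circle_integral h dh s Hh Hs1))).
- rewrite Rmult_0_l in Hc. apply Rminus_diag_uniq in Hc. rewrite Hc.
  rewrite (RInt_ext _ (fun _ => Re (h 0))).
  + rewrite RInt_const. unfold scal; simpl; unfold mult; simpl. ring.
  + intros t _. do 2 f_equal. unfold polar. now rewrite !Rmult_0_l.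
Qed.

Lemma Re_ge_0_center (h : C -> C) (r : R) :
  continuously_holomorphic h -> 0 < r < 1 ->
  (forall z, Cmod z = r -> 0 <= Re (h z)) -> 0 <= Re (h 0).
Proof.
intros Hh Hr Hpos.
assert (HPI := PI_RGT_0).
apply Rmult_le_reg_l with (2 * PI); [lra|].
rewrite Rmult_0_r, <- (circle_mean_value h r Hh Hr).
apply RInt_ge_0; [lra | |].
- apply ex_RInt_Re_polar; trivial. apply Rabs_def1; lra.
- intros t _. apply Hpos. rewrite Cmod_polar. apply Rabs_pos_eq; lra.
Qed.

(** * Caratheodory's inequality *)

Lemma continuous_C_AbsRing (T : UniformSpace) (h : T -> C) (x : T) :
  continuous (U := C_UniformSpace) h x <->
  continuous (U := AbsRing_UniformSpace C_AbsRing) h x.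
Proof.
split; intros H P HP; apply H, locally_C, HP.
Qed.

Lemma continuous_Cmult (h k : C -> C) (z : C) :
  continuous (T := C_UniformSpace) (U := C_UniformSpace) h z ->
  continuous (T := C_UniformSpace) (U := C_UniformSpace) k z ->
  continuous (T := C_UniformSpace) (U := C_UniformSpace) (fun w => (h w * k w)%C) z.
Proof.
intros Hh Hk. apply continuous_C_AbsRing.
apply (continuous_mult (K := C_AbsRing)); now apply continuous_C_AbsRing.
Qed.

Lemma continuously_holomorphic_const (c : C) : continuously_holomorphic (fun _ => c).
Proof.
exists (fun _ => RtoC 0). intros z _. split.
- apply (is_derive_const (K := C_AbsRing) (V := C_NormedModule)).
- apply continuous_const.
Qed.

Lemma continuously_holomorphic_id : continuously_holomorphic (fun z => z).
Proof.
exists (fun _ => RtoC 1). intros z _. split.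
- apply is_derive_C_AbsRing, (is_derive_id (K := C_AbsRing)).
- apply continuous_const.
Qed.

Lemma continuously_holomorphic_plus (h k : C -> C) :
  continuously_holomorphic h -> continuously_holomorphic k ->
  continuously_holomorphic (fun z => (h z + k z)%C).
Proof.
intros [dh Hh] [dk Hk]. exists (fun z => (dh z + dk z)%C). intros z Hz.
destruct (Hh z Hz) as [Hh1 Hh2], (Hk z Hz) as [Hk1 Hk2]. split.
- exact (is_derive_plus (K := C_AbsRing) (V := C_NormedModule) h k z _ _ Hh1 Hk1).
- exact (continuous_plus (V := C_NormedModule) dh dk z Hh2 Hk2).
Qed.

Lemma continuously_holomorphic_mult (h k : C -> C) :
  continuously_holomorphic h -> continuously_holomorphic k ->
  continuously_holomorphic (fun z => (h z * k z)%C).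
Proof.
intros [dh Hh] [dk Hk]. exists (fun z => (dh z * k z + h z * dk z)%C). intros z Hz.
destruct (Hh z Hz) as [Hh1 Hh2], (Hk z Hz) as [Hk1 Hk2]. split.
- now apply is_derive_Cmult.
- apply (continuous_plus (V := C_NormedModule)); apply continuous_Cmult; trivial.
  + now apply is_derive_C_continuous with (dk z).
  + now apply is_derive_C_continuous with (dh z).
Qed.

Lemma continuously_holomorphic_inv (h : C -> C) :
  continuously_holomorphic h -> (forall z, unit_disc z -> h z <> 0) ->
  continuously_holomorphic (fun z => (/ h z)%C).
Proof.
intros [dh Hh] Hnz. exists (fun z => (dh z * - / h z ^ 2)%C). intros z Hz.
destruct (Hh z Hz) as [Hh1 Hh2]. split.
- apply is_derive_Cinv; auto.
- apply continuous_Cmult; trivial.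
  apply (continuous_opp (V := C_NormedModule) (fun w => / h w ^ 2)%C).
  apply (continuous_comp h (fun w => / w ^ 2)%C).
  + now apply is_derive_C_continuous with (dh z).
  + apply (continuous_comp (fun w => w ^ 2)%C Cinv).
    * apply continuous_Cmult; [apply continuous_id|].
      apply continuous_Cmult; [apply continuous_id | apply continuous_const].
    * apply is_derive_C_continuous with (- / (h z ^ 2) ^ 2)%C.
      apply is_derive_Cinv_id, Cpow_nz. auto.
Qed.

Lemma continuously_holomorphic_pow (n : nat) : continuously_holomorphic (fun z => (z ^ n)%C).
Proof.
induction n as [|n IH]; [exact (continuously_holomorphic_const 1)|].
apply (continuously_holomorphic_mult (fun z => z) (fun z => z ^ n)%C); trivial.
apply continuously_holomorphic_id.
Qed.

(* On the circle [|z| = r], [Re (e c (Cconj z)^k) = Re (Cconj (e c) z^k)] and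
   [z * Cconj z = r^2] turn each factor [Cconj z] into a holomorphic expression. *)
Lemma Re_conj_pow_holomorphic (n : nat) : forall (q : nat -> C -> C) (c : nat -> C) (e : C) (r : R),
  (forall k, continuously_holomorphic (q k)) ->
  (forall k z, unit_disc z -> q k z = (c k + z * q (S k) z)%C) ->
  0 < r < 1 ->
  exists K : C -> C, continuously_holomorphic K /\
    K 0 = (r ^ (2 * n) * (e * c n))%C /\
    forall z, Cmod z = r -> Re (e * q 0%nat z * Cconj z ^ n)%C = Re (K z).
Proof.
induction n as [|n IH]; intros q c e r Hq Hc Hr.
- exists (fun z => e * q 0%nat z)%C. split; [|split].
  + apply continuously_holomorphic_mult; [apply continuously_holomorphic_const | apply Hq].
  + rewrite Hc by (unfold unit_disc; rewrite Cmod_0; lra). simpl. ring.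
  + intros z _. f_equal. simpl. ring.
- destruct (IH (fun k => q (S k)) (fun k => c (S k)) e r) as [K [HK1 [HK2 HK3]]]; auto.
  exists (fun z => Cconj (e * c 0%nat) * z ^ S n + r ^ 2 * K z)%C. split; [|split].
  + apply continuously_holomorphic_plus.
    * apply (continuously_holomorphic_mult (fun _ => _) (fun z => z ^ S n)%C).
      apply continuously_holomorphic_const. apply continuously_holomorphic_pow.
    * apply continuously_holomorphic_mult; [apply continuously_holomorphic_const | trivial].
  + rewrite HK2. replace (2 * S n)%nat with (2 + 2 * n)%nat by lia.
    rewrite Cpow_add_r, Cpow_S. ring.
  + intros z Hz.
    rewrite Hc by (unfold unit_disc; lra).
    assert (Hzz : (z * Cconj z)%C = RtoC (r ^ 2)) by (rewrite <- Cmod2_conj, Hz; trivial).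
    replace (e * (c 0%nat + z * q 1%nat z) * Cconj z ^ S n)%C
      with (e * c 0%nat * Cconj z ^ S n + (z * Cconj z) * (e * q 1%nat z * Cconj z ^ n))%C
      by (rewrite Cpow_S; ring).
    assert (HRe : forall u v, Re (u + v)%C = Re u + Re v) by reflexivity.
    rewrite !HRe, Hzz. f_equal.
    * rewrite <- Cpow_conj. unfold Re, Cconj; simpl; ring.
    * rewrite <- RtoC_pow.
      assert (HReR : forall (x : R) u, Re (x * u)%C = x * Re u)
        by (intros; unfold Re; simpl; ring).
      rewrite !HReR, HK3; trivial.
Qed.

(** Let [r] tend to 1 from the left. This removes the radius from a coefficient estimate on
    circles. *)
Lemma le_of_mul_pow_le (x y : R) (n : nat) :
  0 < x -> (forall r, 0 < r < 1 -> x * r ^ n <= y) -> x <= y.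
Proof.
intros Hx H.
assert (Hlim : filterlim (fun r => x * r ^ n) (at_left 1) (locally (x * 1 ^ n))).
{ apply (filterlim_filter_le_1 (F := locally 1)); [apply filter_le_within; apply locally_filter|].
  apply (ex_derive_continuous (V := R_NormedModule) (fun r => x * r ^ n) 1).
  auto_derive. trivial. }
rewrite pow1, Rmult_1_r in Hlim.
apply (filterlim_le (F := at_left 1) (fun r => x * r ^ n) (fun _ => y) x y).
- exists (mkposreal 1 Rlt_0_1). intros r Hr Hr1. apply H.
  apply Rabs_def2 in Hr. simpl in Hr. unfold minus, plus, opp in Hr; simpl in Hr. lra.
- exact Hlim.
- apply filterlim_const.
Qed.

(** The expansion of [q 0] with coefficients [c] is given by its successive remainders [q k], so
    finitely many algebraic steps reach [c n] and no infinite sum is handled. *)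
Lemma caratheodory_coefficient (q : nat -> C -> C) (c : nat -> C) (n : nat) :
  (forall k, continuously_holomorphic (q k)) ->
  (forall k z, unit_disc z -> q k z = (c k + z * q (S k) z)%C) ->
  (forall z, unit_disc z -> 0 < Re (q 0%nat z)) ->
  c 0%nat = 1 -> (0 < n)%nat -> Cmod (c n) <= 2.
Proof.
intros Hq Hc Hpos Hc0 Hn.
destruct (Ceq_dec (c n) 0) as [H0|H0].
{ rewrite H0, Cmod_0. lra. }
assert (Hm : 0 < Cmod (c n)) by now apply Cmod_gt_0.
set (e := (Cconj (c n) / Cmod (c n))%C).
assert (Hmne : RtoC (Cmod (c n)) <> 0) by (intros H; apply RtoC_inj in H; lra).
assert (Hec : (e * c n)%C = Cmod (c n)).
{ unfold e. replace (Cconj (c n) / Cmod (c n) * c n)%C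
    with (c n * Cconj (c n) / Cmod (c n))%C by (field; exact Hmne).
  rewrite <- Cmod2_conj, RtoC_pow. field; exact Hmne. }
assert (He : Cmod e = 1).
{ unfold e. rewrite Cmod_div, Cmod_conj, Cmod_R, Rabs_pos_eq by (trivial; lra). field. lra. }
apply (le_of_mul_pow_le _ _ n Hm). intros r Hr.
destruct (Re_conj_pow_holomorphic n q c e r Hq Hc Hr) as [K [HK1 [HK2 HK3]]].
assert (Hrn : 0 < r ^ n) by (apply pow_lt; lra).
(* On the circle, [K] has the real part of [e * q 0 z * Cconj z ^ n]. Together with the term in
   [Cconj e * z ^ n] it yields [Re (q 0 z)] times [2 * Re (e * Cconj z ^ n)], while [Phi] stays
   holomorphic. *)
set (Phi := fun z => (q 0%nat z * (2 * r ^ n + - Cconj e * z ^ n) + - (1) * K z)%C).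
assert (HPhi : continuously_holomorphic Phi).
{ apply continuously_holomorphic_plus; apply continuously_holomorphic_mult; trivial.
  - apply continuously_holomorphic_plus; [apply continuously_holomorphic_const|].
    apply continuously_holomorphic_mult; [apply continuously_holomorphic_const|].
    apply continuously_holomorphic_pow.
  - apply continuously_holomorphic_const. }
assert (HPhi0 : Phi 0 = RtoC (2 * r ^ n - Cmod (c n) * r ^ n * r ^ n)).
{ unfold Phi. rewrite HK2, Hec, Hc, Hc0 by (unfold unit_disc; rewrite Cmod_0; lra).
  replace (2 * n)%nat with (n + n)%nat by lia. rewrite Cpow_add_r.
  (* For positive [n] the term with [z ^ n] vanishes at the origin. *)
  destruct n as [|n]; [lia|].
  rewrite RtoC_minus, !RtoC_mult, !RtoC_pow. simpl. ring. }
apply Rmult_le_reg_r with (r ^ n); [exact Hrn|].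
enough (0 <= 2 * r ^ n - Cmod (c n) * r ^ n * r ^ n) by lra.
change (0 <= Re (RtoC (2 * r ^ n - Cmod (c n) * r ^ n * r ^ n))).
rewrite <- HPhi0. apply Re_ge_0_center with r; trivial. intros z Hz.
assert (Hp := Hpos z ltac:(unfold unit_disc; lra)).
assert (Hbound : Re (e * Cconj z ^ n)%C <= r ^ n).
{ eapply Rle_trans; [apply Rle_abs|]. eapply Rle_trans; [apply re_le_Cmod|].
  rewrite Cmod_mult, Cmod_pow, Cmod_conj, He, Hz. lra. }
replace (Re (Phi z)) with (Re (q 0%nat z) * (2 * (r ^ n - Re (e * Cconj z ^ n)%C))).
- apply Rmult_le_pos; lra.
- unfold Phi.
  replace (q 0%nat z * (2 * r ^ n + - Cconj e * z ^ n) + - (1) * K z)%C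
    with (r ^ n * (2 * q 0%nat z) + - (q 0%nat z * Cconj (e * Cconj z ^ n)) + - K z)%C
    by (rewrite Cmult_conj, Cpow_conj, Cconj_conj; ring).
  transitivity (Re (r ^ n * (2 * q 0%nat z))%C
    + - Re (q 0%nat z * Cconj (e * Cconj z ^ n))%C + - Re (K z)); [|reflexivity].
  rewrite <- HK3 by exact Hz.
  replace (e * q 0%nat z * Cconj z ^ n)%C with (q 0%nat z * (e * Cconj z ^ n))%C by ring.
  rewrite <- RtoC_pow.
  destruct (e * Cconj z ^ n)%C as [u v]. destruct (q 0%nat z) as [x y].
  unfold Re, Cconj; simpl. ring.
Qed.

(** * Complex power series *)

(** The sum as a total function: [iota] selects the limit at points of convergence. *)
Definition CPSeries (b : nat -> C) (z : C) : C :=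
  iota (T := C_CompleteNormedModule)
    (fun l : C => is_pseries (K := C_AbsRing) (V := C_NormedModule) b z l).

Lemma is_pseries_C_inj (b : nat -> C) (z l m : C) :
  is_pseries (K := C_AbsRing) (V := C_NormedModule) b z l ->
  is_pseries (K := C_AbsRing) (V := C_NormedModule) b z m -> l = m.
Proof.
apply (filterlim_locally_unique (K := C_AbsRing) (V := C_NormedModule)).
Qed.

Lemma CPSeries_unique (b : nat -> C) (z l : C) :
  is_pseries (K := C_AbsRing) (V := C_NormedModule) b z l -> CPSeries b z = l.
Proof.
intros H. apply (iota_unique (K := C_AbsRing) (V := C_CompleteNormedModule)).
- intros y Hy. exact (is_pseries_C_inj b z y l Hy H).
- exact H.
Qed.

Lemma CPSeries_correct (b : nat -> C) (z : C) :
  ex_pseries (K := C_AbsRing) (V := C_NormedModule) b z ->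
  is_pseries (K := C_AbsRing) (V := C_NormedModule) b z (CPSeries b z).
Proof.
intros [l Hl]. now rewrite (CPSeries_unique b z l Hl).
Qed.

Definition converges_on_disc (b : nat -> C) : Prop :=
  forall z, unit_disc z -> ex_pseries (K := C_AbsRing) (V := C_NormedModule) b z.

Lemma pow_n_C (z : C) (n : nat) : pow_n (K := C_AbsRing) z n = (z ^ n)%C.
Proof.
induction n as [|n IH]; [reflexivity|]. simpl. rewrite IH. reflexivity.
Qed.

Lemma is_pseries_C (b : nat -> C) (z l : C) :
  is_pseries (K := C_AbsRing) (V := C_NormedModule) b z l <->
  is_series (K := C_AbsRing) (V := C_NormedModule) (fun n => (b n * z ^ n)%C) l.
Proof.
assert (H : forall n, (pow_n (K := C_AbsRing) z n * b n = b n * z ^ n)%C)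
  by (intros n; rewrite pow_n_C; apply Cmult_comm).
split; apply is_series_ext; intros n; [|symmetry]; apply H.
Qed.

Lemma converges_on_disc_decr (b : nat -> C) :
  converges_on_disc b -> converges_on_disc (fun n => b (S n)).
Proof.
intros H z Hz. apply (ex_pseries_decr_1 (K := C_AbsRing) (V := C_NormedModule)); auto.
destruct (Ceq_dec z 0) as [H0|H0]; [now left|]. right. exists (/ z)%C. now apply Cinv_l.
Qed.

Lemma CPSeries_decr (b : nat -> C) (z : C) : converges_on_disc b -> unit_disc z ->
  CPSeries b z = (b 0%nat + z * CPSeries (fun n => b (S n)) z)%C.
Proof.
intros H Hz. apply CPSeries_unique, is_pseries_C.
apply (is_series_decr_1 (K := C_AbsRing) (V := C_NormedModule)).
assert (H1 := CPSeries_correct _ z (converges_on_disc_decr b H z Hz)).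
apply is_pseries_C in H1.
apply (is_series_scal (K := C_AbsRing) (V := C_NormedModule) z) in H1.
match goal with |- is_series _ ?l =>
  replace l with (scal (V := C_ModuleSpace) z (CPSeries (fun n => b (S n)) z)) end.
- revert H1. apply is_series_ext. intros n.
  change (z * (b (S n) * z ^ n) = b (S n) * (z * z ^ n))%C. ring.
- change (z * CPSeries (fun n => b (S n)) z
    = b 0%nat + z * CPSeries (fun n => b (S n)) z + - (b 0%nat * 1))%C. ring.
Qed.

Lemma converges_on_disc_sub_scal (b h : nat -> C) (c : C) :
  converges_on_disc b -> converges_on_disc h ->
  converges_on_disc (fun n => (b n - c * h n)%C).
Proof.
intros Hb Hh z Hz. eexists.
apply (is_pseries_minus (K := C_AbsRing) (V := C_NormedModule)).
- apply CPSeries_correct. now apply Hb.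
- apply (is_pseries_scal (K := C_AbsRing) (V := C_NormedModule) c); [apply Cmult_comm|].
  apply CPSeries_correct. now apply Hh.
Qed.

Lemma CPSeries_sub_scal (b h : nat -> C) (c z : C) :
  converges_on_disc b -> converges_on_disc h -> unit_disc z ->
  CPSeries (fun n => b n - c * h n)%C z = (CPSeries b z - c * CPSeries h z)%C.
Proof.
intros Hb Hh Hz. apply CPSeries_unique.
apply (is_pseries_minus (K := C_AbsRing) (V := C_NormedModule)).
- apply CPSeries_correct. now apply Hb.
- apply (is_pseries_scal (K := C_AbsRing) (V := C_NormedModule) c); [apply Cmult_comm|].
  apply CPSeries_correct. now apply Hh.
Qed.

(** Convergence at a real point [s] between [r] and 1 bounds the terms there, so the real series of
    moduli has radius at least [s]. This carries the real theory of the radius of convergence over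
    to complex series. *)
Lemma converges_on_disc_CV_radius (b : nat -> C) (r : R) :
  converges_on_disc b -> 0 <= r < 1 -> Rbar_lt r (CV_radius (fun n => Cmod (b n))).
Proof.
intros H Hr.
set (s := (r + 1) / 2).
assert (Hs : r < s < 1) by (unfold s; lra).
assert (Hds : unit_disc s) by (unfold unit_disc; rewrite Cmod_R, Rabs_pos_eq; lra).
destruct (H s Hds) as [l Hl].
destruct (filterlim_bounded (K := C_AbsRing) (V := C_NormedModule) _ (ex_intro _ l Hl)) as [M HM].
apply Rbar_lt_le_trans with s; [simpl; lra|].
apply (proj1 (CV_radius_bounded (fun n => Cmod (b n)))).
exists (2 * M). intros n.
(* A term is the difference of two consecutive partial sums, each bounded by [M]. *)
assert (Hterm : Cmod (s ^ n * b n) <= 2 * M).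
{ assert (HM0 := HM 0%nat). destruct n as [|n].
  - rewrite sum_O in HM0. change (Cmod (1 * b 0%nat) <= M) in HM0.
    assert (Hge := Cmod_ge_0 (1 * b 0%nat)). simpl. lra.
  - assert (HM1 := HM n). assert (HM2 := HM (S n)). rewrite sum_Sn in HM2.
    set (u := sum_n _ n) in *.
    change (Cmod u <= M) in HM1.
    change (Cmod (u + pow_n (K := C_AbsRing) (RtoC s) (S n) * b (S n)) <= M) in HM2.
    rewrite pow_n_C in HM2.
    assert (HT := Cmod_triangle (u + s ^ S n * b (S n)) (- u)).
    rewrite Cmod_opp in HT.
    replace (u + s ^ S n * b (S n) + - u)%C with (s ^ S n * b (S n))%C in HT by ring.
    lra. }
rewrite Cmod_mult, Cmod_pow, Cmod_R, Rabs_pos_eq in Hterm by lra.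
rewrite Rabs_pos_eq; [lra|].
apply Rmult_le_pos; [apply Cmod_ge_0 | apply pow_le; lra].
Qed.

Lemma converges_on_disc_of_CV_radius (b : nat -> C) :
  (forall r, 0 <= r < 1 -> Rbar_lt r (CV_radius (fun n => Cmod (b n)))) ->
  converges_on_disc b.
Proof.
intros H z Hz.
apply (ex_series_le (K := C_AbsRing) (V := C_CompleteNormedModule) _
  (fun n => Rabs (Cmod (b n) * Cmod z ^ n))).
- intros n. change (Cmod (pow_n (K := C_AbsRing) z n * b n) <= Rabs (Cmod (b n) * Cmod z ^ n)).
  rewrite pow_n_C, Cmod_mult, Cmod_pow, Rmult_comm. apply Rle_abs.
- apply CV_disk_inside. rewrite Rabs_pos_eq by apply Cmod_ge_0. apply H.
  split; [apply Cmod_ge_0 | exact Hz].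
Qed.

Definition CPS_derive (b : nat -> C) (n : nat) : C := (INR (S n) * b (S n))%C.

(** The moduli of the differentiated coefficients form the real derived series of the moduli, and
    [CV_radius_derive] says that its radius is unchanged. *)
Lemma converges_on_disc_derive (b : nat -> C) :
  converges_on_disc b -> converges_on_disc (CPS_derive b).
Proof.
intros H. apply converges_on_disc_of_CV_radius. intros r Hr.
rewrite (CV_radius_ext _ (PS_derive (fun n => Cmod (b n)))).
- rewrite CV_radius_derive. now apply converges_on_disc_CV_radius.
- intros n. unfold CPS_derive, PS_derive.
  rewrite Cmod_mult, Cmod_R, Rabs_pos_eq by apply pos_INR. reflexivity.
Qed.

Lemma is_series_Cmod_le (a : nat -> C) (c : nat -> R) (l : C) (s : R) :
  is_series (K := C_AbsRing) (V := C_NormedModule) a l -> is_series c s ->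
  (forall n, Cmod (a n) <= c n) -> Cmod l <= s.
Proof.
intros Ha Hc Hle.
apply (is_lim_seq_le (fun n => norm (K := C_AbsRing) (V := C_NormedModule) (sum_n a n))
  (sum_n c) (Cmod l) s).
- intros n. eapply Rle_trans; [apply (norm_sum_n_m (K := C_AbsRing) (V := C_NormedModule))|].
  now apply sum_n_m_le.
- apply (filterlim_comp _ _ _ _ _ _ _ _ Ha
    (filterlim_norm (K := C_AbsRing) (V := C_NormedModule) l)).
- exact Hc.
Qed.

Lemma Cmod_le_sub_add (z w : C) : Cmod z <= Cmod (z - w) + Cmod w.
Proof.
assert (H := Cmod_triangle (z - w) w). now replace (z - w + w)%C with z in H by ring.
Qed.

(** With [m = n + 2], the first-order remainder [R_m] of the [m]-th power satisfies
    [R_(m+1) = z R_m + m w^(m-1) (z-w)^2], which drives the induction. The factor [m (m-1)], twice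
    the sharp one, matches the coefficients of a second derivative. *)
Lemma Cmod_pow_taylor (z w : C) (rho : R) (n : nat) :
  Cmod z <= rho -> Cmod w <= rho ->
  Cmod (z ^ S (S n) - w ^ S (S n) - INR (S (S n)) * w ^ S n * (z - w))
  <= INR (S (S n)) * INR (S n) * rho ^ n * Cmod (z - w) ^ 2.
Proof.
intros Hz Hw.
assert (Hrho : 0 <= rho) by (assert (H := Cmod_ge_0 z); lra).
induction n as [|n IH].
- replace (z ^ 2 - w ^ 2 - INR 2 * w ^ 1 * (z - w))%C with ((z - w) ^ 2)%C
    by (simpl; rewrite RtoC_plus; ring).
  rewrite Cmod_pow. simpl. assert (H := pow2_ge_0 (Cmod (z - w))). simpl in H. lra.
- replace (z ^ S (S (S n)) - w ^ S (S (S n)) - INR (S (S (S n))) * w ^ S (S n) * (z - w))%C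
    with (z * (z ^ S (S n) - w ^ S (S n) - INR (S (S n)) * w ^ S n * (z - w))
      + INR (S (S n)) * w ^ S n * (z - w) ^ 2)%C
    by (rewrite (S_INR (S (S n))), RtoC_plus, !Cpow_S; ring).
  eapply Rle_trans; [apply Cmod_triangle|].
  rewrite !Cmod_mult, !Cmod_pow, Cmod_R, Rabs_pos_eq by apply pos_INR.
  assert (H1 := pos_INR (S (S n))).
  assert (H2 := pow2_ge_0 (Cmod (z - w))).
  assert (H3 : Cmod w ^ S n <= rho ^ S n) by (apply pow_incr; split; [apply Cmod_ge_0 | trivial]).
  assert (H4 := Rmult_le_compat _ _ _ _ (Cmod_ge_0 z) (Cmod_ge_0 _) Hz IH).
  assert (H5 := Rmult_le_compat_l _ _ _ H1 H3).
  assert (H6 := Rmult_le_compat_r _ _ _ H2 H5).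
  eapply Rle_trans; [exact (Rplus_le_compat _ _ _ _ H4 H6)|].
  (* The two bounds add up to the factor [(n+2)^2], against the required [(n+3)(n+2)]; this term is
     the surplus. *)
  assert (H7 : 0 <= INR (S (S n)) * rho ^ S n * Cmod (z - w) ^ 2)
    by (apply Rmult_le_pos; [apply Rmult_le_pos; [|apply pow_le]|]; trivial).
  apply Rminus_le_0. eapply Rle_trans; [exact H7|]. right.
  rewrite (S_INR (S (S n))), (S_INR (S n)). simpl (rho ^ S n). ring.
Qed.

(** Summing the Taylor remainders of the powers bounds the error by [s * Cmod (z - w) ^ 2], where
    [s] is the sum at [rho] of the twice differentiated series of moduli. *)
Lemma is_derive_CPSeries (b : nat -> C) (w : C) :
  converges_on_disc b -> unit_disc w ->
  is_derive (K := C_AbsRing) (V := C_NormedModule) (CPSeries b) w (CPSeries (CPS_derive b) w).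
Proof.
intros Hb Hw.
set (rho := (Cmod w + 1) / 2).
assert (Hrho : Cmod w < rho < 1) by (unfold unit_disc, rho in *; lra).
assert (Hw0 := Cmod_ge_0 w).
set (c := fun n => INR (S (S n)) * INR (S n) * Cmod (b (S (S n))) * rho ^ n).
assert (Hc : ex_series c).
{ apply ex_series_ext with (fun n => PS_derive (PS_derive (fun n => Cmod (b n))) n * rho ^ n).
  { intros n. unfold PS_derive, c.
    match goal with |- ?x = ?y => change (@eq R x y) end. ring. }
  apply ex_pseries_R, CV_radius_inside. rewrite !CV_radius_derive, Rabs_pos_eq by lra.
  apply converges_on_disc_CV_radius; trivial; lra. }
destruct Hc as [s Hs].
assert (Hs0 := Rabs_pos s).
apply is_derive_C_eps. intros eps Heps.
(* The first bound keeps [z] in the disc of radius [rho]; the second gives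
   [s * Cmod (z - w) <= eps], with [+ 1] keeping the denominator positive. *)
exists (Rmin (rho - Cmod w) (eps / (Rabs s + 1))). split.
{ apply Rmin_pos; [lra|]. apply Rdiv_lt_0_compat; lra. }
intros z Hz.
assert (H1 := Rlt_le_trans _ _ _ Hz (Rmin_l _ _)).
assert (H2 := Rlt_le_trans _ _ _ Hz (Rmin_r _ _)).
assert (Hzr : Cmod z <= rho).
{ assert (HT := Cmod_le_sub_add z w). lra. }
assert (Hzd : unit_disc z) by (unfold unit_disc; lra).
(* Dropping the constant term, which cancels in the difference, aligns the indices with those of
   [CPS_derive b]. *)
assert (Stail : forall x, unit_disc x -> is_series (K := C_AbsRing) (V := C_NormedModule)
  (fun n => b (S n) * x ^ S n)%C (CPSeries b x - b 0%nat)%C).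
{ intros x Hx.
  apply (is_series_incr_1 (K := C_AbsRing) (V := C_NormedModule) (fun n => b n * x ^ n)%C).
  replace (plus _ _) with (CPSeries b x).
  - now apply is_pseries_C, CPSeries_correct, Hb.
  - change (CPSeries b x = CPSeries b x - b 0%nat + b 0%nat * 1)%C. ring. }
assert (Sd := proj1 (is_pseries_C _ _ _)
  (CPSeries_correct _ w (converges_on_disc_derive b Hb w Hw))).
set (E := (CPSeries b z - CPSeries b w - CPSeries (CPS_derive b) w * (z - w))%C).
set (t := fun n => (b (S n) * (z ^ S n - w ^ S n - INR (S n) * w ^ n * (z - w)))%C).
assert (St : is_series (K := C_AbsRing) (V := C_NormedModule) t E).
{ assert (H := is_series_minus (K := C_AbsRing) (V := C_NormedModule) _ _ _ _
    (is_series_minus (K := C_AbsRing) (V := C_NormedModule) _ _ _ _ (Stail z Hzd) (Stail w Hw))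
    (is_series_scal (K := C_AbsRing) (V := C_NormedModule) (z - w)%C _ _ Sd)).
  match type of H with is_series _ ?l => replace l with E in H end.
  - revert H. apply is_series_ext. intros n. unfold t.
    change (b (S n) * z ^ S n + - (b (S n) * w ^ S n) + - ((z - w) * (INR (S n) * b (S n) * w ^ n))
      = b (S n) * (z ^ S n - w ^ S n - INR (S n) * w ^ n * (z - w)))%C. ring.
  - change (E = CPSeries b z - b 0%nat + - (CPSeries b w - b 0%nat)
      + - ((z - w) * CPSeries (CPS_derive b) w))%C. unfold E. ring. }
assert (Hbound : Cmod E <= s * Cmod (z - w) ^ 2).
{ apply (is_series_Cmod_le (fun n => t (S n)) (fun n => c n * Cmod (z - w) ^ 2)).
  - apply (is_series_incr_1 (K := C_AbsRing) (V := C_NormedModule)).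
    match goal with |- is_series _ ?l => replace l with E end; [exact St|].
    (* The linear term has remainder 0, so the sum may start at the quadratic one, where
       [Cmod_pow_taylor] begins. *)
    change (E = E + b 1%nat * (z * 1 - w * 1 - 1 * 1 * (z - w)))%C. ring.
  - now apply is_series_scal_r.
  - intros n. unfold t, c. rewrite Cmod_mult.
    eapply Rle_trans; [apply Rmult_le_compat_l;
      [apply Cmod_ge_0 | apply (Cmod_pow_taylor z w rho n); lra]|].
    right. ring. }
eapply Rle_trans; [exact Hbound|].
assert (Hd := Cmod_ge_0 (z - w)).
replace (s * Cmod (z - w) ^ 2) with (s * Cmod (z - w) * Cmod (z - w)) by ring.
apply Rmult_le_compat_r; [exact Hd|].
apply Rlt_div_r in H2; [|lra]. assert (Hs1 := Rle_abs s). nra.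
Qed.

Lemma continuously_holomorphic_CPSeries (b : nat -> C) :
  converges_on_disc b -> continuously_holomorphic (CPSeries b).
Proof.
intros Hb. exists (CPSeries (CPS_derive b)). intros z Hz.
assert (Hb' := converges_on_disc_derive b Hb). split.
- now apply is_derive_CPSeries.
- apply is_derive_C_continuous with (CPSeries (CPS_derive (CPS_derive b)) z).
  now apply is_derive_CPSeries.
Qed.

(* Power series long division: [b / h = c_0 + z (c_1 + z (c_2 + ...))], where
   [c_k] is the constant term of the [k]-th remainder since [h 0 = 1]. *)
Fixpoint division_remainder (b h : nat -> C) (k : nat) : nat -> C :=
  match k with
  | O => b
  | S k' => fun n => (division_remainder b h k' (S n)
                      - division_remainder b h k' 0%nat * h (S n))%C
  end.

Lemma converges_on_disc_remainder (b h : nat -> C) (k : nat) :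
  converges_on_disc b -> converges_on_disc h ->
  converges_on_disc (division_remainder b h k).
Proof.
intros Hb Hh. induction k as [|k IH]; [exact Hb|].
apply (converges_on_disc_sub_scal (fun n => division_remainder b h k (S n)) (fun n => h (S n)));
  now apply converges_on_disc_decr.
Qed.

(** One division step after dividing by the sum of [h]; it is the recursion between remainders that
    [caratheodory_coefficient] assumes. *)
Lemma CPSeries_remainder (b h : nat -> C) (k : nat) (z : C) :
  converges_on_disc b -> converges_on_disc h -> h 0%nat = 1 ->
  unit_disc z -> CPSeries h z <> 0 ->
  (CPSeries (division_remainder b h k) z * / CPSeries h z
   = division_remainder b h k 0%nat
     + z * (CPSeries (division_remainder b h (S k)) z * / CPSeries h z))%C.
Proof.
intros Hb Hh Hh0 Hz Hnz.
assert (Hk := converges_on_disc_remainder b h k Hb Hh).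
simpl division_remainder at 3.
rewrite (CPSeries_sub_scal (fun n => division_remainder b h k (S n)) (fun n => h (S n)))
  by (trivial; now apply converges_on_disc_decr).
rewrite (CPSeries_decr _ z Hk Hz).
rewrite (CPSeries_decr h z Hh Hz) in *. rewrite Hh0 in *.
field. exact Hnz.
Qed.

Lemma caratheodory_quotient (b h : nat -> C) (n : nat) :
  converges_on_disc b -> converges_on_disc h ->
  b 0%nat = 1 -> h 0%nat = 1 ->
  (forall z, unit_disc z -> CPSeries h z <> 0) ->
  (forall z, unit_disc z -> 0 < Re (CPSeries b z * / CPSeries h z)%C) ->
  (0 < n)%nat -> Cmod (division_remainder b h n 0%nat) <= 2.
Proof.
intros Hb Hh Hb0 Hh0 Hnz Hpos Hn.
apply (caratheodory_coefficient
  (fun k z => CPSeries (division_remainder b h k) z * / CPSeries h z)%C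
  (fun k => division_remainder b h k 0%nat)); trivial.
- intros k. apply continuously_holomorphic_mult.
  + now apply continuously_holomorphic_CPSeries, converges_on_disc_remainder.
  + apply continuously_holomorphic_inv; trivial. now apply continuously_holomorphic_CPSeries.
- intros k z Hz. apply CPSeries_remainder; auto.
Qed.

Lemma unit_disc_locally (z : C) :
  unit_disc z -> locally (T := AbsRing_UniformSpace C_AbsRing) z unit_disc.
Proof.
intros Hz. assert (Hpos : 0 < 1 - Cmod z) by (unfold unit_disc in Hz; lra).
exists (mkposreal _ Hpos). intros w Hw.
change (Cmod (w - z) < 1 - Cmod z) in Hw.
assert (HT := Cmod_le_sub_add w z).
unfold unit_disc. lra.
Qed.

(** * The second Hankel determinant *)

(** Writing [f(z) = z h(z)] turns [z f'(z) / f(z)] into [f'(z) / h(z)], a quotient of two power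
    series with constant term 1, to which [caratheodory_quotient] applies. *)
Lemma starlike_hankel_bound (f : C -> C) (a : nat -> C) :
  starlike f -> normalized_expansion f a ->
  Cmod (a 2%nat * a 4%nat - a 3%nat ^ 2)%C <= 11 / 3.
Proof.
intros [[_ [_ Hinj]] Hre] [Ha0 [Ha1 Ha]].
assert (Hconv : converges_on_disc a) by (intros z Hz; eexists; now apply Ha).
assert (Hf : forall z, unit_disc z -> f z = CPSeries a z)
  by (intros z Hz; symmetry; now apply CPSeries_unique, Ha).
set (h := fun n => a (S n)).
assert (Hh : converges_on_disc h) by now apply converges_on_disc_decr.
assert (Hd : converges_on_disc (CPS_derive a)) by now apply converges_on_disc_derive.
assert (H0disc : unit_disc 0) by (unfold unit_disc; rewrite Cmod_0; lra).
assert (Hfh : forall z, unit_disc z -> f z = (z * CPSeries h z)%C).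
{ intros z Hz. rewrite Hf, CPSeries_decr, Ha0 by trivial. unfold h. ring. }
assert (Hh00 : CPSeries h 0 = 1).
{ rewrite CPSeries_decr by trivial. unfold h. rewrite Ha1. ring. }
assert (Hd00 : CPSeries (CPS_derive a) 0 = 1).
{ rewrite CPSeries_decr by trivial. unfold CPS_derive at 1. rewrite Ha1. simpl. ring. }
(* A zero of [h] away from the origin would be a second zero of [f], against injectivity. *)
assert (Hnz : forall z, unit_disc z -> CPSeries h z <> 0).
{ intros z Hz Habs. destruct (Ceq_dec z 0) as [H0|H0].
  - subst z. rewrite Hh00 in Habs. apply RtoC_inj in Habs. lra.
  - apply H0, Hinj; trivial. rewrite !Hfh, Habs by trivial. ring. }
assert (Hpos : forall z, unit_disc z -> 0 < Re (CPSeries (CPS_derive a) z * / CPSeries h z)%C).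
{ intros z Hz. assert (H := Hre z Hz). unfold starlike_quotient in H.
  destruct (Ceq_dec z 0) as [H0|H0].
  - subst z. rewrite Hh00, Hd00. replace (1 * / 1)%C with (RtoC 1) by field. exact H.
  - rewrite (is_C_derive_unique f z (CPSeries (CPS_derive a) z)) in H.
    + rewrite Hfh in H by trivial.
      replace (CPSeries (CPS_derive a) z * / CPSeries h z)%C
        with (z * CPSeries (CPS_derive a) z / (z * CPSeries h z))%C
        by (field; split; auto).
      exact H.
    + apply (is_derive_ext_loc (K := C_AbsRing) (V := C_NormedModule) (CPSeries a)).
      * generalize (unit_disc_locally z Hz). apply filter_imp.
        intros w Hw. symmetry. now apply Hf.
      * now apply is_derive_CPSeries. }
assert (Hb0 : CPS_derive a 0 = 1) by (unfold CPS_derive; rewrite Ha1; simpl; ring).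
set (c := fun n => division_remainder (CPS_derive a) h n 0%nat).
assert (Hc : forall n, (0 < n)%nat -> Cmod (c n) <= 2)
  by (intros n; now apply caratheodory_quotient).
assert (Hc1 := Hc 1%nat ltac:(lia)). assert (Hc2 := Hc 2%nat ltac:(lia)).
assert (Hc3 := Hc 3%nat ltac:(lia)).
(* The next three identities solve [(n-1) a_n = c_1 a_(n-1) + ... + c_(n-1) a_1] for
   [n = 2, 3, 4]. *)
assert (H2 : a 2%nat = c 1%nat).
{ unfold c, h, CPS_derive; simpl. rewrite Ha1, !RtoC_plus. ring. }
assert (H3 : a 3%nat = ((c 2%nat + c 1%nat ^ 2) / 2)%C).
{ unfold c, h, CPS_derive; simpl. rewrite Ha1, !RtoC_plus. field. }
assert (H4 : a 4%nat = (c 3%nat / 3 + c 1%nat * c 2%nat / 2 + c 1%nat ^ 3 / 6)%C).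
{ unfold c, h, CPS_derive; simpl. rewrite Ha1, !RtoC_plus. field. }
clearbody c.
replace (a 2%nat * a 4%nat - a 3%nat ^ 2)%C
  with (c 1%nat * c 3%nat / 3 + - (c 2%nat ^ 2 / 4) + - (c 1%nat ^ 4 / 12))%C
  by (rewrite H2, H3, H4; field).
assert (Hdiv : forall (x : C) (k : R), 0 < k -> Cmod (x / k) = Cmod x / k).
{ intros x k Hk. rewrite Cmod_div, Cmod_R, Rabs_pos_eq by
    (try (intros H; apply RtoC_inj in H); lra). reflexivity. }
eapply Rle_trans; [apply Cmod_triangle|].
eapply Rle_trans; [apply Rplus_le_compat_r, Cmod_triangle|].
rewrite !Cmod_opp, !Hdiv, !Cmod_mult, !Cmod_pow by lra.
assert (P1 := Cmod_ge_0 (c 1%nat)). assert (P3 := Cmod_ge_0 (c 3%nat)).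
assert (Q13 := Rmult_le_compat _ _ _ _ P1 P3 Hc1 Hc3).
assert (Q2 := pow_incr _ _ 2 (conj (Cmod_ge_0 (c 2%nat)) Hc2)).
assert (Q1 := pow_incr _ _ 4 (conj P1 Hc1)).
lra.
Qed.

Theorem corollary2p2 (f : C -> C) (a : nat -> C)
  (hf : bi_starlike f) (ha : normalized_expansion f a) :
  Cmod (a 2%nat * a 4%nat - a 3%nat ^ 2)%C <= 20 / 3.
Proof.
destruct hf as [_ [hs _]].
assert (H := starlike_hankel_bound f a hs ha). lra.
Qed.
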